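(* Let $G$ be a finite subgroup of $\mathrm{SU}(2)\times\mathrm{SU}(2)$ with $-1=(-1,-1)\in G$, and let $\Gamma=(V,E)$ be its Mckay diagram with respect to the natural $4$-dimensional representation $W$. Then $\Gamma$ is bipartite, and $E$ admits a decomposition $E=E_1\sqcup E_2$ such that: (1) for $i=1,2$, the graph $\Gamma_i=(V,E_i)$ is a disjoint union of simply-laced Euclidean diagrams (i.e. each of its connected components is a simply-laced Euclidean diagram); (2) the Euclidean diagrams from $\Gamma_1$ and $\Gamma_2$ intersect transversally, i.e. every connected component of $\Gamma_1$ and every connected component of $\Gamma_2$ have at least one vertex in common.
   Context: View $\mathrm{SU}(2)\times \mathrm{SU}(2)\subseteq \mathrm{SL}_4(\mathbb{C})$ block-diagonally; $W=\mathbb{C}^4=W_1\oplus W_2$, where $W_k$ is the two-dimensional representation of $G$ obtained by projecting to the $k$-th factor. Let $V_0,\dots,V_r$ be a full list of pairwise non-isomorphic irreducible complex representations of $G$. The Mckay diagram $\Gamma$ of $G$ (with respect to $W$) is the undirected multigraph with vertices $0,\dots,r$ in which $i$ and $j$ are joined by $n_{ij}=\dim_{\mathbb{C}}\mathrm{Hom}_G(V_i,W\otimes V_j)$ edges (one has $n_{ij}=n_{ji}$). The simply-laced Euclidean (extended Dynkin) diagrams are: $\tilde A_n$ ($n\ge 1$), a cycle on $n+1$ vertices, with $\tilde A_1$ being two vertices joined by a double edge; $\tilde D_n$ ($n\ge 4$), on $n+1$ vertices, obtained from a path on $n-3$ vertices by attaching two extra leaves at each end of the path (four leaves at the single vertex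 if $n=4$); and $\tilde E_6,\tilde E_7,\tilde E_8$, the trees with one trivalent vertex and three arms with $(2,2,2)$, $(1,3,3)$, $(1,2,5)$ further vertices respectively. *)

(* Defs.v *)
From HB Require Import structures.
From mathcomp Require Import all_boot all_order all_fingroup all_algebra.
From mathcomp Require Import all_character spectral finmap.

Set Implicit Arguments.
Unset Strict Implicit.
Unset Printing Implicit Defensive.

Import GRing.Theory Num.Theory.
Local Open Scope ring_scope.

Section SpecialUnitary.
Variables (C : numClosedFieldType) (n : nat).

Record SU := MkSU {
  SUval :> 'M[C]_n;
  SUvalP : (SUval \is unitarymx) && (\det SUval == 1) }.

HB.instance Definition _ := [isSub for SUval].
HB.instance Definition _ := [Choice of SU by <:].

Implicit Types A B : SU.

Fact SU_one_subproof :
  ((1%:M : 'M[C]_n) \is unitarymx) && (\det (1%:M : 'M[C]_n) == 1).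
Proof.
by rewrite det1 eqxx andbT; apply/unitarymxP; rewrite trmx1 map_mx1 mulmx1.
Qed.

Fact SU_mul_subproof A B :
  ((A *m B) \is unitarymx) && (\det (A *m B) == 1).
Proof.
have /andP[uA /eqP dA] := SUvalP A; have /andP[uB /eqP dB] := SUvalP B.
by rewrite mul_unitarymx //= det_mulmx dA dB mulr1.
Qed.

Fact SU_inv_subproof A :
  (invmx A \is unitarymx) && (\det (invmx A) == 1).
Proof.
have /andP[uA /eqP dA] := SUvalP A.
by rewrite det_inv dA invr1 eqxx andbT invmx_unitary // trmxC_unitary.
Qed.

Definition SU_one := MkSU SU_one_subproof.
Definition SU_mul A B := MkSU (SU_mul_subproof A B).
Definition SU_inv A := MkSU (SU_inv_subproof A).

Fact SU_mulA : associative SU_mul.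
Proof. by move=> A B D; apply/val_inj; rewrite /= mulmxA. Qed.

Fact SU_mul1 : left_id SU_one SU_mul.
Proof. by move=> A; apply/val_inj; rewrite /= mul1mx. Qed.

Fact SU_mulr1 : right_id SU_one SU_mul.
Proof. by move=> A; apply/val_inj; rewrite /= mulmx1. Qed.

Fact SU_mulV : left_inverse SU_one SU_inv SU_mul.
Proof.
move=> A; apply/val_inj; rewrite /= mulVmx //.
by have /andP[/unitarymx_unit] := SUvalP A.
Qed.

Fact SU_mulrV : right_inverse SU_one SU_inv SU_mul.
Proof.
move=> A; apply/val_inj; rewrite /= mulmxV //.
by have /andP[/unitarymx_unit] := SUvalP A.
Qed.

HB.instance Definition _ := isGroup.Build SU SU_mulA SU_mul1 SU_mulr1
  SU_mulV SU_mulrV.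

End SpecialUnitary.

Section FiniteSubgroup.
Variable T : groupType.

Record fin_subgroup := FinSubgroup {
  fin_subgroup_set :> {fset T};
  fin_subgroup_closed : group_closed (mem fin_subgroup_set) }.

Variable G : fin_subgroup.

(* The finite group G as a type, with the group law inherited from T. *)
Definition elts : Type := fset_sub_type G.

HB.instance Definition _ := SubType.on elts.
HB.instance Definition _ := Finite.on elts.

Implicit Types x y : elts.

Fact elts_one_subproof : 1%g \in fin_subgroup_set G.
Proof. by case: (fin_subgroup_closed G). Qed.

Fact elts_mul_subproof x y : (val x * val y)%g \in fin_subgroup_set G.
Proof.
exact: (group_closedM (fin_subgroup_closed G)) (valP x) (valP y).
Qed.

Fact elts_inv_subproof x : (val x)^-1%g \in fin_subgroup_set G.
Proof. exact: (group_closedV (fin_subgroup_closed G)) (valP x). Qed.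

Definition elts_one : elts := FSetSub elts_one_subproof.
Definition elts_mul x y : elts := FSetSub (elts_mul_subproof x y).
Definition elts_inv x : elts := FSetSub (elts_inv_subproof x).

Fact elts_mulA : associative elts_mul.
Proof. by move=> x y z; apply/val_inj; rewrite /= mulgA. Qed.

Fact elts_mul1 : left_id elts_one elts_mul.
Proof. by move=> x; apply/val_inj; rewrite /= mul1g. Qed.

Fact elts_mulV : left_inverse elts_one elts_inv elts_mul.
Proof. by move=> x; apply/val_inj; rewrite /= mulVg. Qed.

HB.instance Definition _ :=
  Finite_isGroup.Build elts elts_mulA elts_mul1 elts_mulV.

End FiniteSubgroup.

Section NaturalRepresentation.
Variable C : numClosedFieldType.

Fact SU2_N1_subproof :
  (- 1%:M \is @unitarymx C 2 2) && (\det (- 1%:M : 'M[C]_2) == 1).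
Proof.
rewrite -scaleN1r detZ det1 sqrrN expr1n mulr1 eqxx andbT.
apply/unitarymxP; rewrite scaleN1r linearN /= trmx1 map_mxN map_mx1.
by rewrite mulmxN mulNmx opprK mulmx1.
Qed.

Definition SU2_N1 : SU C 2 := MkSU SU2_N1_subproof.

Variable G : fin_subgroup (SU C 2 * SU C 2)%type.

Definition natural_mx (g : elts G) : 'M[C]_(2 + 2) :=
  block_mx (val g).1 0 0 (val g).2.

Fact natural_mx_repr : mx_repr [set: elts G] natural_mx.
Proof.
split=> [|g h _ _]; first by rewrite /natural_mx -scalar_mx_block.
by rewrite mulmx_block !(mulmx0, mul0mx, addr0, add0r).
Qed.

Definition natural_repr : mx_representation C [set: elts G] (2 + 2) :=
  MxRepresentation natural_mx_repr.

End NaturalRepresentation.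

Section HomSpace.
Variables (F : fieldType) (gT : finGroupType) (G : {group gT}).
Variables (m n : nat).
Variables (rV : mx_representation F G m) (rW : mx_representation F G n).

(* Hom_G(V, W): as usual in the library, representations act on row vectors. *)
Definition hom_space : {vspace 'M[F]_(m, n)} :=
  (\bigcap_(g in G) lker (linfun (mulmx (rV g)) - linfun (mulmxr (rW g))))%VS.

Lemma hom_spaceP (f : 'M[F]_(m, n)) :
  reflect {in G, forall g, rV g *m f = f *m rW g} (f \in hom_space).
Proof.
have homE g : (f \in lker (linfun (mulmx (rV g)) - linfun (mulmxr (rW g))))
    = (rV g *m f == f *m rW g).
  by rewrite memv_ker add_lfunE opp_lfunE !lfunE /= subr_eq0.
rewrite memvE; apply: (iffP subv_bigcapP) => hf g Gg.
  by apply/eqP; rewrite -homE memvE hf.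
by rewrite -memvE homE hf.
Qed.

End HomSpace.

Definition irr_list (F : fieldType) (gT : finGroupType) (G : {group gT})
    (r : nat) (d : 'I_r.+1 -> nat)
    (V : forall i, mx_representation F G (d i)) : Prop :=
  [/\ forall i, mx_irreducible (V i),
      forall i j, mx_rsim (V i) (V j) -> i = j
    & forall n (rG : mx_representation F G n),
        mx_irreducible rG -> exists i, mx_rsim rG (V i)].

(* A multigraph is given by the number of edges joining two vertices. *)
Definition multigraph (V : finType) := V -> V -> nat.

Definition mckay (C : numClosedFieldType)
    (G : fin_subgroup (SU C 2 * SU C 2)%type) (r : nat) (d : 'I_r.+1 -> nat)
    (V : forall i, mx_representation C [set: elts G] (d i)) :
    multigraph 'I_r.+1 :=
  fun i j => \dim (hom_space (V i) (prod_repr (natural_repr G) (V j))).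

Section Multigraphs.
Variable V : finType.
Implicit Types (Q : multigraph V) (X Y : {set V}).

Definition undirected Q := forall x y, Q x y = Q y x.

Definition adjacent Q : rel V := fun x y => (0 < Q x y)%N.

Definition bipartite Q :=
  exists c : V -> bool, forall x y, adjacent Q x y -> c x != c y.

Definition components Q : {set {set V}} :=
  [set [set y | connect (adjacent Q) x y] | x : V].

(* The edge set of Q is the disjoint union of those of Q1 and Q2. *)
Definition edge_decomposition Q Q1 Q2 :=
  [/\ undirected Q1, undirected Q2
    & forall x y, Q x y = (Q1 x y + Q2 x y)%N].

Definition transversal_components Q1 Q2 :=
  forall X Y, X \in components Q1 -> Y \in components Q2 -> X :&: Y != set0.

End Multigraphs.

(* Vertices 0, ..., n - 1, edges listed with multiplicity (and no loops). *)
Definition of_edges (n : nat) (s : seq (nat * nat)) : multigraph 'I_n :=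
  fun x y => (count_mem (val x, val y) s + count_mem (val y, val x) s)%N.

Definition A_edges (n : nat) : seq (nat * nat) :=
  (n, 0%N) :: [seq (k, k.+1) | k <- iota 0 n].

(* The path is on 0, ..., n - 4; the leaves are n - 3, ..., n. *)
Definition D_edges (n : nat) : seq (nat * nat) :=
  [:: (0, n - 3); (0, n - 2); (n - 4, n - 1); (n - 4, n)]%N
    ++ [seq (k, k.+1) | k <- iota 0 (n - 4)].

(* In the E diagrams the trivalent vertex is 0. *)
Definition E6_edges : seq (nat * nat) :=
  [:: (0, 1); (1, 2); (0, 3); (3, 4); (0, 5); (5, 6)]%N.

Definition E7_edges : seq (nat * nat) :=
  [:: (0, 1); (0, 2); (2, 3); (3, 4); (0, 5); (5, 6); (6, 7)]%N.

Definition E8_edges : seq (nat * nat) :=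
  [:: (0, 1); (0, 2); (2, 3); (0, 4); (4, 5); (5, 6); (6, 7); (7, 8)]%N.

Inductive euclidean : forall n : nat, multigraph 'I_n -> Prop :=
  | EuclideanA n of (1 <= n)%N : euclidean (@of_edges n.+1 (A_edges n))
  | EuclideanD n of (4 <= n)%N : euclidean (@of_edges n.+1 (D_edges n))
  | EuclideanE6 : euclidean (@of_edges 7 E6_edges)
  | EuclideanE7 : euclidean (@of_edges 8 E7_edges)
  | EuclideanE8 : euclidean (@of_edges 9 E8_edges).

Definition euclidean_union (V : finType) (Q : multigraph V) : Prop :=
  forall X, X \in components Q ->
    exists (n : nat) (D : multigraph 'I_n) (f : 'I_n -> V),
      [/\ euclidean D, injective f, f @: setT = X
        & forall a b, Q (f a) (f b) = D a b].

(* Main.v *)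
Require Import Defs.
From mathcomp Require Import all_boot all_order all_fingroup all_algebra.
From mathcomp Require Import all_character finmap reals complex.
From mathcomp Require Import spectral zify boolp.

(** The natural representation is the sum of the representations [W1] and [W2]
    on the two factors, so the McKay graph is the edge-disjoint union of the
    graphs [Q1] and [Q2] in which the vertices [i] and [j] are joined by
    [dim Hom(V_i, W_k * V_j)] edges (lemma [mckay_split]). Everything else is
    read off from characters through [dim_hom_space], the formula
    [dim Hom(V, W) = |G|^-1 \sum_g tr V(g^-1) tr W(g)]. The characters [w1], [w2]
    of [W1] and [W2] satisfy [w (g^-1) = w g], because traces in SU(2) do, and
    therefore both graphs are undirected.

    Bipartiteness: the central element (-1, -1) acts by a sign on each [V_i] and
    by -1 on [W1] and [W2], so an edge of either graph joins representations on
    which the signs differ (lemma [tensor_graph_bipartite]). In particular there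
    are no loops.

    Euclidean components: decomposing [W_k * V_i] into irreducibles and comparing
    degrees gives [2 d_i = \sum_j n_ij d_j], so the vector of degrees is a
    positive eigenvector of the adjacency matrix for the eigenvalue 2 (lemma
    [tensor_graph_harmonic]). A connected graph with such a vector [d] that
    contains an affine diagram coincides with it: the null vector [w] of the
    diagram satisfies [Q w >= 2 w], and pairing with [d] forces equality (lemma
    [embedding_onto]). It remains to find a diagram inside each component. A
    double edge or a cycle, a vertex of degree 4, and two branch vertices with a
    path between them are diagrams of type A or D. Otherwise the component is a
    tree with at most one branch vertex, along whose arms [d] is linear. A
    branch vertex with arms of lengths [p], [q], [r] then satisfies
    [1/(p+1) + 1/(q+1) + 1/(r+1) = 1], which leaves the three diagrams of type E
    (lemma [no_three_arms]), and a component without branch vertex is impossible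
    (lemma [branchless_contra]).

    Transversality: multiplication by [w1] carries the span of the characters in
    a component of [Q1] to itself, and similarly for [w2] and [Q2]. If the
    component of [i] in [Q1] and that of [j] in [Q2] were disjoint,
    [p1(w1) chi_i] and [p2(w2) chi_j] would thus be orthogonal for all
    polynomials [p1], [p2]. By unitarity [w1 g = w2 g = 2] only for [g = 1], so
    polynomials that vanish at the values of [w1] and [w2] other than 2 reduce
    the pairing to its term at 1, a nonzero multiple of [d_i d_j] (lemma
    [tensor_graphs_transversal]). *)

Set Implicit Arguments.
Unset Strict Implicit.
Unset Printing Implicit Defensive.

(** * Edge lists of the affine diagrams *)

Section EdgeLists.
Implicit Types (n a b k : nat) (es : seq (nat * nat)) (w : nat -> nat).

Definition in_range n es := all (fun uv => (uv.1 < n) && (uv.2 < n)) es.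

(** No edge is listed twice, in either orientation; this makes all
    multiplicities of [of_edges n es] at most 1. *)
Definition simple_edges es :=
  uniq es && all (fun uv => (uv.2, uv.1) \notin es) es.

Lemma count_simple_edges es a b : simple_edges es ->
  count_mem (a, b) es + count_mem (b, a) es
    = ((a, b) \in es) || ((b, a) \in es).
Proof.
case/andP=> ues /allP sw; rewrite !count_uniq_mem //.
by have := sw (a, b); case: ((a, b) \in es) => // /(_ isT) /negbTE->.
Qed.

(** The adjacency operator of [of_edges n es] applied to [w], computed edge by
    edge, so that it can be evaluated on edge lists of variable length. *)
Definition edge_sum es w a :=
  \sum_(uv <- es) ((uv.1 == a) * w uv.2 + (uv.2 == a) * w uv.1).

Lemma sum_of_edges n es w (a : 'I_n) : in_range n es ->
  \sum_(b < n) of_edges es a b * w b = edge_sum es w a.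
Proof.
rewrite /of_edges /edge_sum.
elim: es => [|[u v] es IH] /=.
  by move=> _; rewrite big_nil big1.
case/andP=> /andP[lu lv] /IH {}IH; rewrite big_cons -IH /=.
have pick k (F : nat -> nat) : k < n -> \sum_(b < n) (k == b) * F b = F k.
  move=> lk; rewrite (bigD1 (Ordinal lk)) //= eqxx mul1n big1 ?addn0 // => b.
  by rewrite -val_eqE /= eq_sym => /negbTE->.
rewrite -(pick v (fun b => (u == a) * w b)) //.
rewrite -(pick u (fun b => (v == a) * w b)) //.
rewrite -!big_split /=; apply: eq_bigr => b _.
rewrite !xpair_eqE; do 4!case: eqP => _; lia.
Qed.

Lemma edge_sum_cons uv es w a :
  edge_sum (uv :: es) w a
    = (uv.1 == a) * w uv.2 + (uv.2 == a) * w uv.1 + edge_sum es w a.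
Proof. exact: big_cons. Qed.

Lemma edge_sum_path m w a :
  edge_sum [seq (k, k.+1) | k <- iota 0 m] w a
    = (a < m) * w a.+1 + ((0 < a) && (a <= m)) * w a.-1.
Proof.
rewrite /edge_sum big_map; elim: m => [|m IH].
  by rewrite big_nil; case: a.
rewrite -addn1 iotaD big_cat IH big_seq1 /= add0n.
rewrite addn1; have [-> | nam] := eqVneq m a.
  by rewrite ltnn ltnSn leqnn leqnSn; case: (0 < a); lia.
have [<- | nam1] := eqVneq m.+1 a.
  by rewrite ltnNge leqnSn !ltnn leqnn /=; lia.
have [am | ma] := ltnP a m.
  have [-> -> ->]: [/\ a < m.+1, a <= m & a <= m.+1] by split; lia.
  by case: (0 < a); lia.
have [-> -> ->]: [/\ (a < m.+1) = false, (a <= m) = false & (a <= m.+1) = false].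
  by split; lia.
by rewrite !andbF; lia.
Qed.

Lemma mem_path_edges m a b :
  ((a, b) \in [seq (k, k.+1) | k <- iota 0 m]) = (b == a.+1) && (a < m).
Proof.
apply/mapP/andP => [[k + [-> ->]]|[/eqP-> lam]].
  by rewrite mem_iota.
by exists a => //; rewrite mem_iota.
Qed.

Lemma uniq_path_edges m : uniq [seq (k, k.+1) | k <- iota 0 m].
Proof. by rewrite map_inj_uniq ?iota_uniq // => i j []. Qed.

Lemma simple_A_edges n : 1 < n -> simple_edges (A_edges n).
Proof.
move=> n1; rewrite /simple_edges /A_edges cons_uniq uniq_path_edges.
rewrite mem_path_edges andbT; apply/andP; split; first by lia.
apply/allP => -[a b]; rewrite !inE !xpair_eqE !mem_path_edges /=; lia.
Qed.

Lemma simple_D_edges n : 3 < n -> simple_edges (D_edges n).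
Proof.
move=> n3; rewrite /simple_edges /D_edges !cat_cons !cons_uniq uniq_path_edges.
rewrite !inE !xpair_eqE !mem_path_edges; apply/andP; split; first by lia.
apply/allP => -[a b]; rewrite !inE !xpair_eqE !mem_path_edges /=; lia.
Qed.

Lemma in_range_A n : in_range n.+1 (A_edges n).
Proof.
apply/allP => -[a b]; rewrite !inE !xpair_eqE !mem_path_edges /=; lia.
Qed.

Lemma in_range_D n : 3 < n -> in_range n.+1 (D_edges n).
Proof.
move=> n3; apply/allP => -[a b].
rewrite !inE !xpair_eqE !mem_path_edges /=; lia.
Qed.

Lemma A_edge_sum n a : a <= n -> edge_sum (A_edges n) (fun=> 1) a = 2.
Proof.
move=> an; rewrite edge_sum_cons edge_sum_path ?muln1 /=; lia.
Qed.

(** The null vector of the affine diagram: 1 on the four leaves and 2 on the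
    path. *)
Definition D_mark n k := if k <= n - 4 then 2 else 1.

Lemma D_edge_sum n a : 3 < n -> a <= n ->
  edge_sum (D_edges n) (D_mark n) a = 2 * D_mark n a.
Proof.
move=> n3 an; rewrite /D_edges !edge_sum_cons edge_sum_path /=.
have path k : k <= n - 4 -> D_mark n k = 2 by rewrite /D_mark => ->.
have leaf k : n - 4 < k -> D_mark n k = 1.
  by rewrite /D_mark ltnNge => /negbTE->.
rewrite !(path 0) ?(path (n - 4)) ?(leaf (n - 3)) ?(leaf (n - 2)) //; try lia.
rewrite ?(leaf (n - 1)) ?(leaf n) //; try lia.
have [an4 | n4a] := leqP a (n - 4).
  rewrite (path a) // andbT (path a.-1); last lia.
  have [an4' | n4a'] := ltnP a (n - 4); first by rewrite path; lia.
  lia.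
rewrite (leaf a) //.
have [-> ->]: (a < n - 4) = false /\ (0 < a) && false = false by lia.
lia.
Qed.
End EdgeLists.

(** * Affine diagrams inside graphs with a positive eigenvector *)

Section HarmonicGraph.
Variables (V : finType) (Q : multigraph V) (d : V -> nat).
Hypothesis Qsym : undirected Q.
Hypothesis loopless : forall x, Q x x = 0.
Hypothesis d_gt0 : forall x, 0 < d x.
Hypothesis harmonic : forall x, \sum_y Q x y * d y = 2 * d x.

Local Notation e := (adjacent Q).

Lemma adjacent_sym : symmetric e.
Proof. by move=> x y; rewrite /adjacent Qsym. Qed.

Lemma adjacent_irr x : e x x = false.
Proof. by rewrite /adjacent loopless. Qed.

Lemma adjacent_neq x y : e x y -> x != y.
Proof. by apply: contraTneq => ->; rewrite adjacent_irr. Qed.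

Definition euclidean_on (X : {set V}) : Prop :=
  exists (n : nat) (D : multigraph 'I_n) (f : 'I_n -> V),
    [/\ euclidean D, injective f, f @: setT = X
      & forall a b, Q (f a) (f b) = D a b].

Variable r : V.
Let X : {set V} := [set y | connect e r y].

Lemma adjacent_in_component x y : x \in X -> e x y -> y \in X.
Proof. by rewrite !inE => rx /connect1; apply: connect_trans. Qed.

(** Extending [w] by zero gives [W] on [V] with [2 W <= Q W] pointwise. Pairing
    with the positive solution [d] of [Q d = 2 d], and using that [Q] is
    symmetric, shows [<d, Q W> = <Q d, W> = 2 <d, W>], so that no inequality can
    be strict. Equality off the image says that no edge leaves the image;
    equality on it says that [Q] has no more edges there than [D]. *)
Lemma embedding_onto n (D : multigraph 'I_n) (f : 'I_n -> V) (w : 'I_n -> nat)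
    (a0 : 'I_n) :
    euclidean D -> injective f -> (forall a, f a \in X) ->
    (forall a b, D a b <= Q (f a) (f b)) -> (forall a, 0 < w a) ->
    (forall a, 2 * w a <= \sum_b D a b * w b) ->
  euclidean_on X.
Proof.
move=> eD injf fX DQ w0 Dw.
pose W y := \sum_b (f b == y) * w b.
have Wf a : W (f a) = w a.
  rewrite /W (bigD1 a) //= eqxx mul1n big1 ?addn0 // => b ba.
  by rewrite (inj_eq injf) (negbTE ba).
pose S x := \sum_b Q x (f b) * w b.
have QW x : \sum_y Q x y * W y = S x.
  under eq_bigr do rewrite big_distrr.
  rewrite exchange_big /=; apply: eq_bigr => b _.
  rewrite (bigD1 (f b)) //= eqxx mul1n big1 ?addn0 // => y yb.
  by rewrite eq_sym (negbTE yb) mul0n muln0.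
have DS a : \sum_b D a b * w b <= S (f a).
  by apply: leq_sum => b _; rewrite leq_mul2r DQ orbT.
have W0 y : y \notin f @: setT -> W y = 0.
  move=> yf; rewrite /W big1 // => b _; case: eqP => // fby.
  by rewrite -fby imset_f in yf.
have WS x : 2 * W x <= S x.
  have [/imsetP[a _ ->]|/W0-> //] := boolP (x \in f @: setT).
  by rewrite Wf (leq_trans (Dw a) (DS a)).
have dWS : \sum_x d x * (2 * W x) = \sum_x d x * S x.
  transitivity (\sum_x W x * (2 * d x)); first by apply: eq_bigr => x _; lia.
  under eq_bigr do rewrite -harmonic big_distrr.
  rewrite exchange_big /=; apply: eq_bigr => y _; rewrite -QW big_distrr /=.
  by apply: eq_bigr => x _; rewrite Qsym; lia.
have SW x : S x = 2 * W x.
  have le1 y : true -> d y * (2 * W y) <= d y * S y ?= iff (2 * W y == S y).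
    by move=> _; split; rewrite ?leq_mul2l ?WS ?orbT // eqn_mul2l eqn0Ngt d_gt0.
  have [_] := leqif_sum le1; rewrite dWS eqxx => /esym/forallP/(_ x)/eqP.
  by [].
have f_closed : forall x y, x \in f @: setT -> e x y -> y \in f @: setT.
  move=> _ y /imsetP[a _ ->]; rewrite adjacent_sym => ya; apply: contraTT ya => yf.
  have := SW y; rewrite W0 // muln0 => /eqP; rewrite sum_nat_eq0 => /forallP/(_ a).
  by rewrite muln_eq0 (gtn_eqF (w0 a)) orbF /adjacent lt0n negbK.
exists n, D, f; split=> // [|a b].
  apply/setP=> y; apply/idP/idP; first by case/imsetP=> a _ ->.
  rewrite inE => ry; have: connect e (f a0) y.
    apply: connect_trans ry; rewrite (sym_connect_sym adjacent_sym).
    by have := fX a0; rewrite inE.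
  case/connectP=> p; have: f a0 \in f @: setT by apply: imset_f.
  elim: p (f a0) => [|z p IH] x xf /=; first by move=> _ ->.
  by case/andP=> xz; apply: IH; apply: f_closed xz.
have DSa : \sum_b D a b * w b = S (f a).
  by apply/eqP; rewrite eqn_leq DS SW Wf Dw.
have le1 c : true ->
    D a c * w c <= Q (f a) (f c) * w c ?= iff (D a c == Q (f a) (f c)).
  by move=> _; split; rewrite ?leq_mul2r ?DQ ?orbT // eqn_mul2r (gtn_eqF (w0 c)).
have [_] := leqif_sum le1; rewrite DSa eqxx => /esym/forallP/(_ b)/eqP.
by [].
Qed.

Lemma edge_embedding n es (s : seq V) (w : nat -> nat) :
    euclidean (@of_edges n es) -> 0 < n -> in_range n es ->
    size s = n -> uniq s -> {subset s <= X} ->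
    (forall a b, a < n -> b < n ->
       count_mem (a, b) es + count_mem (b, a) es <= Q (nth r s a) (nth r s b)) ->
    (forall a, a < n -> (0 < w a) && (2 * w a <= edge_sum es w a)) ->
  euclidean_on X.
Proof.
move=> eD n0 rng sz us sX cQ ww.
apply: (@embedding_onto n _ (fun a => nth r s a) w (Ordinal n0) eD).
- by move=> a b /eqP; rewrite nth_uniq ?sz ?ltn_ord // => /eqP/val_inj.
- by move=> a; apply/sX/mem_nth; rewrite sz.
- by move=> a b; apply: cQ (ltn_ord a) (ltn_ord b).
- by move=> a; case/andP: (ww a (ltn_ord a)).
- by move=> a; rewrite sum_of_edges //; case/andP: (ww a (ltn_ord a)).
Qed.

Lemma simple_embedding n es (s : seq V) (w : nat -> nat) :
    euclidean (@of_edges n es) -> 0 < n -> in_range n es -> simple_edges es ->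
    size s = n -> uniq s -> {subset s <= X} ->
    all (fun uv => e (nth r s uv.1) (nth r s uv.2)) es ->
    (forall a, a < n -> (0 < w a) && (2 * w a <= edge_sum es w a)) ->
  euclidean_on X.
Proof.
move=> eD n0 rng ses sz us sX /allP esQ.
apply: edge_embedding eD n0 rng sz us sX _ => a b _ _.
rewrite count_simple_edges //; have [/esQ|_] := boolP ((a, b) \in es).
  by rewrite /= => /leq_trans->.
by have [/esQ|_] := boolP ((b, a) \in es); rewrite //= adjacent_sym.
Qed.

Lemma double_edge_euclidean x y : x \in X -> 1 < Q x y -> euclidean_on X.
Proof.
move=> xX xy.
have exy : e x y by apply: leq_trans xy.
apply: (@edge_embedding 2 (A_edges 1) [:: x; y] (fun=> 1)) => //.
- exact: EuclideanA.
- by rewrite /= inE (adjacent_neq exy).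
- move=> z; rewrite !in_cons orbF => /orP[]/eqP-> //.
  exact: adjacent_in_component exy.
- by move=> [|[|//]] [|[|//]] _ _ //=; rewrite Qsym.
- by move=> a la; rewrite A_edge_sum.
Qed.

Lemma path_in_component x p : x \in X -> path e x p -> {subset x :: p <= X}.
Proof.
elim: p x => [|y p IH] x xX /=; first by move=> _ z; rewrite mem_seq1 => /eqP->.
case/andP=> xy yp z; rewrite in_cons => /predU1P[-> //|].
by apply: IH => //; apply: adjacent_in_component xy.
Qed.

Lemma cycle_euclidean s : path.cycle e s -> uniq s -> 2 < size s ->
  {subset s <= X} -> euclidean_on X.
Proof.
case: s => // x p cp up sp sX; pose n := size p.
apply: (@simple_embedding n.+1 (A_edges n) (x :: p) (fun=> 1)) => //.
- by apply: EuclideanA; rewrite /n; case: (p) sp.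
- exact: in_range_A.
- exact: simple_A_edges.
- move: cp; rewrite /= rcons_path => /andP[/(pathP r) xp px].
  rewrite -[n]/(size p) nth_last /= px /=; apply/allP => -[a b].
  by rewrite mem_path_edges => /andP[/eqP-> /xp].
- by move=> a la; rewrite A_edge_sum.
Qed.

(** The path may be trivial, in which case [x] has four neighbours and the
    diagram is the star with four leaves. *)
Lemma forked_path_euclidean x p a b a' b' : path e x p -> x \in X ->
    uniq (x :: p ++ [:: a; b; a'; b']) ->
    e x a -> e x b -> e (last x p) a' -> e (last x p) b' ->
  euclidean_on X.
Proof.
move=> xp xX us xa xb xa' xb'; pose n := size p + 4.
have n4 : n - 4 = size p by rewrite /n addnK.
have lX : last x p \in X by apply: (path_in_component xX xp); apply: mem_last.
pose s := x :: p ++ [:: a; b; a'; b'].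
apply: (@simple_embedding n.+1 (D_edges n) s (D_mark n)) => //.
- by apply: EuclideanD; rewrite /n; lia.
- by apply: in_range_D; rewrite /n; lia.
- by apply: simple_D_edges; rewrite /n; lia.
- by rewrite /= size_cat.
- move=> z; rewrite /s -cat_cons mem_cat => /orP[|].
    exact: path_in_component xp z.
  by rewrite !in_cons orbF => /or4P[]/eqP->;
    [ apply: adjacent_in_component xa | apply: adjacent_in_component xb
    | apply: adjacent_in_component xa' | apply: adjacent_in_component xb' ].
- have nthp k : k <= size p -> nth r s k = nth r (x :: p) k.
    by move=> kp; rewrite /s -cat_cons nth_cat /= ltnS kp.
  have nthl k : nth r s (size p + k.+1) = nth r [:: a; b; a'; b'] k.
    by rewrite /s -cat_cons nth_cat /= ltnNge addnS ltnS leq_addr /= subSS addKn.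
  rewrite /D_edges !all_cat n4; apply/andP; split.
    rewrite /= -[x in e x _ && _]/(nth r s 0).
    have -> : n - 3 = size p + 1 by rewrite /n; lia.
    have -> : n - 2 = size p + 2 by rewrite /n; lia.
    have -> : n - 1 = size p + 3 by rewrite /n; lia.
    rewrite -[n]/(size p + 4) !nthl nthp ?nthp //= -[size p]/(size (x :: p)).-1.
    by rewrite !nth_last /= xa xb xa' xb'.
  apply/allP => -[i j]; rewrite mem_path_edges => /andP[/eqP-> /= ip].
  by rewrite nthp ?(ltnW ip) // nth_cat ip; move: xp => /(pathP r)/(_ i ip).
- move=> i; rewrite ltnS => lin; rewrite D_edge_sum ?leqnn ?andbT //.
    by rewrite /D_mark; case: ifP.
  by rewrite /n; lia.
Qed.

Lemma arms_in_component c A B C : c \in X ->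
    path e c A -> path e c B -> path e c C -> {subset c :: A ++ B ++ C <= X}.
Proof.
move=> cX pA pB pC z; rewrite in_cons !mem_cat => /or4P[/eqP->//|||] zs.
- by apply: (path_in_component cX pA); rewrite in_cons zs orbT.
- by apply: (path_in_component cX pB); rewrite in_cons zs orbT.
- by apply: (path_in_component cX pC); rewrite in_cons zs orbT.
Qed.

Lemma E6_euclidean c a1 a2 b1 b2 c1 c2 : c \in X ->
    path e c [:: a1; a2] -> path e c [:: b1; b2] -> path e c [:: c1; c2] ->
    uniq [:: c; a1; a2; b1; b2; c1; c2] ->
  euclidean_on X.
Proof.
move=> cX pa pb pc us.
(* The marks of the affine diagram, its null vector. *)
pose w := nth 0 [:: 3; 2; 1; 2; 1; 2; 1].
apply: (@simple_embedding 7 E6_edges [:: c; a1; a2; b1; b2; c1; c2] w) => //.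
- exact: EuclideanE6.
- exact: arms_in_component pa pb pc.
- by move: pa pb pc; rewrite /= => /and3P[-> -> _] /and3P[-> -> _] /and3P[-> -> _].
- rewrite /edge_sum; move=> a.
  by do 7?[case: a => [|a]]; rewrite // !big_cons big_nil.
Qed.

Lemma E7_euclidean c a1 b1 b2 b3 c1 c2 c3 : c \in X ->
    path e c [:: a1] -> path e c [:: b1; b2; b3] ->
    path e c [:: c1; c2; c3] ->
    uniq [:: c; a1; b1; b2; b3; c1; c2; c3] ->
  euclidean_on X.
Proof.
move=> cX pa pb pc us; pose w := nth 0 [:: 4; 2; 3; 2; 1; 3; 2; 1].
apply: (@simple_embedding 8 E7_edges [:: c; a1; b1; b2; b3; c1; c2; c3] w) => //.
- exact: EuclideanE7.
- exact: arms_in_component pa pb pc.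
- move: pa pb pc; rewrite /= => /andP[-> _] /and4P[-> -> -> _].
  by case/and4P=> -> -> ->.
- rewrite /edge_sum; move=> a.
  by do 8?[case: a => [|a]]; rewrite // !big_cons big_nil.
Qed.

Lemma E8_euclidean c a1 b1 b2 c1 c2 c3 c4 c5 : c \in X ->
    path e c [:: a1] -> path e c [:: b1; b2] ->
    path e c [:: c1; c2; c3; c4; c5] ->
    uniq [:: c; a1; b1; b2; c1; c2; c3; c4; c5] ->
  euclidean_on X.
Proof.
move=> cX pa pb pc us; pose w := nth 0 [:: 6; 3; 4; 2; 5; 4; 3; 2; 1].
apply: (@simple_embedding 9 E8_edges [:: c; a1; b1; b2; c1; c2; c3; c4; c5] w) => //.
- exact: EuclideanE8.
- exact: arms_in_component pa pb pc.
- move: pa pb pc; rewrite /= => /andP[-> _] /and3P[-> -> _].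
  by case/and5P=> -> -> -> -> /andP[-> _].
- rewrite /edge_sum; move=> a.
  by do 9?[case: a => [|a]]; rewrite // !big_cons big_nil.
Qed.

(** * Shape of a component that is not Euclidean *)

Section NotEuclidean.
Hypothesis notE : ~ euclidean_on X.

Lemma multiplicity x y : x \in X -> Q x y = e x y.
Proof.
move=> xX; rewrite /adjacent; case: (Q x y) (@double_edge_euclidean x y xX).
  by [].
by case=> // q /(_ isT).
Qed.

Definition nbrs x := [set y | e x y].

Lemma sum_nbrs x : x \in X -> \sum_(y in nbrs x) d y = 2 * d x.
Proof.
move=> xX; rewrite -harmonic big_mkcond /=; apply: eq_bigr => y _.
by rewrite inE multiplicity //; case: (e x y); rewrite ?mul1n.
Qed.

Lemma path_rev x p : path e (last x p) (rev (belast x p)) = path e x p.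
Proof. by rewrite -[RHS]rev_path; apply: eq_path => y z; rewrite adjacent_sym. Qed.

(** Acyclicity, in the form in which it is used: two paths that leave [c] in
    different directions and meet again enclose a cycle, which is a Euclidean
    diagram. The condition on [ohead] also allows one path to be empty. *)
Lemma fork_disjoint c p q : c \in X -> path e c p -> path e c q ->
  uniq (c :: p) -> uniq (c :: q) -> ohead p != ohead q -> ~~ has (mem p) q.
Proof.
move=> cX cp cq up uq pq; apply/negP => pqI; apply: notE.
case/split_find: pqI cq uq pq => x q1 q2 xp q1p.
case/splitPr: p / xp cp up q1p => p1 p2 cp up q1p cq uq pq.
apply: (@cycle_euclidean (c :: p1 ++ x :: rev q1)).
- rewrite /= rcons_cat cat_path /=.
  move: cp cq; rewrite !cat_path /= => /and3P[-> -> _] /andP[+ _] /=.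
  by rewrite -path_rev last_rcons belast_rcons rev_cons.
- move: up uq; rewrite /= !cat_uniq !mem_cat !rcons_uniq mem_rcons !in_cons /=.
  rewrite !mem_rev rev_uniq => /andP[+ /and4P[-> + xp2 _]].
  rewrite !negb_or => /and3P[-> -> _] /andP[xp1 _].
  case/andP=> /andP[/andP[_ ->] _] /andP[/andP[xq1 ->] _]; rewrite xq1 /= andbT.
  rewrite xp1 /=.
  apply/hasPn => z; rewrite mem_rev => zq; apply: contra q1p => zp.
  by apply/hasP; exists z; rewrite //= mem_cat zp.
- rewrite /= size_cat /= size_rev.
  case: p1 q1 pq {cp up q1p cq uq} => [|? ?] [|? ?] //=; try lia.
  by rewrite eqxx.
move=> z; rewrite in_cons mem_cat in_cons mem_rev => /or4P[/eqP-> //|zp|/eqP->|zq].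
- by apply: (path_in_component cX cp); rewrite in_cons mem_cat zp orbT.
- by apply: (path_in_component cX cp); rewrite in_cons mem_cat mem_head !orbT.
- apply: (path_in_component cX cq).
  by rewrite in_cons mem_cat mem_rcons in_cons zq !orbT.
Qed.

Lemma uniq_size (s : seq V) : uniq s -> size s <= #|V|.
Proof. by move=> us; rewrite -(card_uniqP us) max_card. Qed.

(** A longest path ends at a leaf: a neighbour of its end that is already on
    the path, other than the preceding vertex, would violate
    [fork_disjoint]. *)
Lemma path_to_leaf c y : c \in X -> e c y ->
  exists p, [/\ path e c (y :: p), uniq (c :: y :: p)
              & nbrs (last y p) = [set last c (belast y p)]].
Proof.
move=> cX cy.
(* The bound [m] is on the number of vertices still off the path. *)
suff IH m p : #|V| - size p <= m -> path e c (y :: p) -> uniq (c :: y :: p) ->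
    exists p, [/\ path e c (y :: p), uniq (c :: y :: p)
                & nbrs (last y p) = [set last c (belast y p)]].
  apply: (IH _ [::] (leqnn _)); first by rewrite /= cy.
  by rewrite /= inE (adjacent_neq cy).
elim: m p => [|m IH] p pm cp up.
  by have := uniq_size up; move: pm; clear; rewrite /=; move: #|V| => v; lia.
pose z := last y p.
have [w /andP[zw wp] | none] := pickP [pred w | e z w & w \notin c :: y :: p].
  apply: (IH (rcons p w)).
  - have := uniq_size up; move: pm; clear; rewrite size_rcons /=.
    by move: #|V| => v; lia.
  - by rewrite -rcons_cons rcons_path cp.
  by rewrite -!rcons_cons rcons_uniq wp.
exists p; split=> //.
have zX : z \in X by apply: (path_in_component cX cp); rewrite in_cons mem_last orbT.
have ez : e z (last c (belast y p)).
  rewrite adjacent_sym /z; case/lastP: p {pm up none z zX} cp => [|p w].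
    by case/andP.
  by rewrite -rcons_cons rcons_path belast_rcons last_rcons => /andP[].
apply/setP=> w; rewrite !inE; apply/idP/eqP => [zw|-> //].
apply/eqP; apply: contraT => wc.
pose q := rev (belast c (y :: p)).
have zq : path e z q by rewrite /z -[last y p]/(last c (y :: p)) path_rev.
have uzq : uniq (z :: q).
  by move: up; rewrite -rev_uniq lastI rev_rcons.
have zwp : w \in q.
  have := none w; rewrite /= zw /= => /negbFE.
  by rewrite lastI mem_rcons in_cons mem_rev eq_sym (negbTE (adjacent_neq zw)).
have := @fork_disjoint z [:: w] q zX _ zq _ uzq.
rewrite /= zw /= inE (adjacent_neq zw) => /(_ isT isT).
have -> : ohead q = Some (last c (belast y p)).
  by rewrite /q /= lastI rev_rcons.
rewrite (inj_eq Some_inj) wc => /(_ isT) /hasP[]; exists w => //.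
by rewrite /= mem_head.
Qed.

(** Along an arm without branching, [2 d x = d x' + d x''] for consecutive
    vertices [x'], [x], [x''], and [2 d x = d x'] at the leaf, so [d] grows
    linearly from the leaf: the values are [t], [2 t], [3 t] and so on. *)
Lemma arm_values c y p : c \in X -> path e c (y :: p) -> uniq (c :: y :: p) ->
    nbrs (last y p) = [set last c (belast y p)] ->
    {in belast y p, forall x, #|nbrs x| <= 2} ->
  d c = (size p).+2 * d (last y p) /\ d y = (size p).+1 * d (last y p).
Proof.
elim: p c y => [|z p IH] c y cX /andP[cy yp] up leaf deg2.
  have yX := adjacent_in_component cX cy.
  by have := sum_nbrs yX; rewrite leaf big_set1 /=; lia.
have yX := adjacent_in_component cX cy.
have up' : uniq (y :: z :: p) by case/andP: up.
have deg2' : {in belast z p, forall x, #|nbrs x| <= 2}.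
  by move=> x xp; apply: deg2; rewrite /= in_cons xp orbT.
have [dy dz] := IH y z yX yp up' leaf deg2'.
rewrite -/(last y (z :: p)) in dy dz *; rewrite dy /=.
have cz : c != z by move: up; rewrite /= !inE !negb_or => /andP[/and3P[]].
have /andP[yz _] := yp.
have Ny : nbrs y = [set c; z].
  apply/esym/eqP; rewrite eqEcard cards2 cz deg2 ?mem_head // andbT.
  by apply/subsetP => x; rewrite !inE => /orP[]/eqP->; rewrite // adjacent_sym.
have := sum_nbrs yX; rewrite Ny big_setU1 ?inE // big_set1 dy dz /=.
by split=> //; lia.
Qed.

Lemma two_more_nbrs x u : 2 < #|nbrs x| ->
  exists a b, [/\ e x a, e x b, a != b, a != u & b != u].
Proof.
move=> deg; have /card_gt1P[a [b]]: 1 < #|nbrs x :\ u|.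
  by have := cardsD1 u (nbrs x); case: (u \in _) => /=; lia.
by rewrite !inE => -[/andP[au xa] /andP[bu xb] ab]; exists a, b.
Qed.

Lemma degree_le3 x : x \in X -> #|nbrs x| <= 3.
Proof.
move=> xX; rewrite leqNgt; apply/negP => /card_geqP[s [us ss sN]]; apply: notE.
case: s ss us sN => [|a [|b [|a' [|b' []]]]] //= _ us sN.
have xs z : z \in [:: a; b; a'; b'] -> e x z by move/sN; rewrite inE.
have nx : x \notin [:: a; b; a'; b'].
  by apply/negP => /xs; rewrite adjacent_irr.
apply: (@forked_path_euclidean x [::] a b a' b') => //; first by apply/andP.
all: by apply: xs; rewrite !in_cons eqxx ?orbT.
Qed.

(** Two branch vertices and a path between them would form a forked path, a
    Euclidean diagram. *)
Lemma branch_unique x y : x \in X -> y \in X ->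
  2 < #|nbrs x| -> 2 < #|nbrs y| -> x = y.
Proof.
move=> xX yX degx degy.
have /connectP[p' xp' yp']: connect e x y.
  move: xX yX; rewrite !inE => rx; apply: connect_trans.
  by rewrite (sym_connect_sym adjacent_sym).
move: yp'; case/shortenP: xp' => p xp up _ yp; apply/eqP/negPn/negP => xy.
apply: notE; pose q := rev (belast x p).
have yq : path e y q by rewrite yp path_rev.
have uq : uniq (y :: q) by rewrite yp -rev_rcons -lastI rev_uniq.
have [a [b [xa xb ab ap bp]]] := two_more_nbrs (head x p) degx.
have [a' [b' [ya' yb' ab' aq' bq']]] := two_more_nbrs (head y q) degy.
have p0 : p != [::] by apply: contraNneq xy => pE; rewrite yp pE.
have q0 : q != [::] by rewrite -size_eq0 size_rev size_belast size_eq0.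
(* On a path from [z], only the next vertex is adjacent to [z]. *)
have off z t s : z \in X -> path e z s -> uniq (z :: s) -> s != [::] ->
    e z t -> t != head z s -> t \notin z :: s.
  move=> zX zs us s0 zt ts.
  have := @fork_disjoint z s [:: t] zX zs; rewrite /= zt inE (adjacent_neq zt).
  move=> /(_ isT us isT); case: s s0 {zs us} ts => // h s _ /= ts.
  rewrite (inj_eq Some_inj) eq_sym ts orbF => /(_ isT) tp.
  by rewrite in_cons eq_sym negb_or (adjacent_neq zt).
have off_y t : e y t -> t != head y q -> t \notin x :: p.
  move=> yt tq; have := off y t q yX yq uq q0 yt tq.
  by rewrite yp -rev_rcons -lastI mem_rev.
have off_x t t' : e x t -> t != head x p -> e y t' -> t' != head y q -> t != t'.
  move=> xt tp yt' tq'.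
  have := off x t (rcons p t') xX; rewrite rcons_path xp -yp yt'.
  rewrite -rcons_cons rcons_uniq up andbT off_y // => /(_ isT isT).
  rewrite -size_eq0 size_rcons => /(_ isT xt).
  have -> : head x (rcons p t') = head x p by case: (p) p0.
  by move=> /(_ tp); rewrite mem_rcons in_cons negb_or => /andP[].
have offxp t : e x t -> t != head x p -> t \notin x :: p.
  by apply: off.
apply: (@forked_path_euclidean x p a b a' b') => //; rewrite -?yp //.
have [na nb] := (offxp a xa ap, offxp b xb bp).
have [na' nb'] := (off_y a' ya' aq', off_y b' yb' bq').
have [naa' nab'] := (off_x a a' xa ap ya' aq', off_x a b' xa ap yb' bq').
have [nba' nbb'] := (off_x b a' xb bp ya' aq', off_x b b' xb bp yb' bq').
rewrite -cat_cons cat_uniq up [has _ _]/= (negbTE na) (negbTE nb) (negbTE na').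
by rewrite (negbTE nb') /= !inE !negb_or ab naa' nab' nba' nbb' ab'.
Qed.

(** [p] lists an arm outwards from [c], and [t] is the value of [d] at its
    leaf; the last condition is the conclusion of [arm_values]. *)
Definition arm c p t :=
  [/\ path e c p, uniq (c :: p), 0 < t & d c = (size p).+1 * t].

Lemma arms_disjoint c A B C : c \in X ->
    path e c A -> uniq (c :: A) -> path e c B -> uniq (c :: B) ->
    path e c C -> uniq (c :: C) ->
    ohead A != ohead B -> ohead A != ohead C -> ohead B != ohead C ->
  uniq (c :: A ++ B ++ C).
Proof.
move=> cX pA uA pB uB pC uC hAB hAC hBC.
have AB := fork_disjoint cX pA pB uA uB hAB.
have AC := fork_disjoint cX pA pC uA uC hAC.
have BC := fork_disjoint cX pB pC uB uC hBC.
move: uA uB uC; rewrite !cons_uniq => /andP[cA uA] /andP[cB uB] /andP[cC uC].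
by rewrite !cat_uniq !mem_cat has_cat !negb_or cA cB cC uA uB uC AB AC BC.
Qed.

(** If the arms have [p], [q] and [r] vertices, the conditions amount to
    [1/(p+1) + 1/(q+1) + 1/(r+1) = 1], whose solutions (2,2,2), (1,3,3) and
    (1,2,5) are the three exceptional diagrams. Arms at least as long as in one of
    the first two solutions contain that diagram after truncation, which is
    enough because an embedded diagram is the whole component; shorter ones
    contradict the relation, unless their lengths are 1, 2 and 5. *)
Lemma no_three_arms c A a B b C g : c \in X ->
    arm c A a -> arm c B b -> arm c C g ->
    ohead A != ohead B -> ohead A != ohead C -> ohead B != ohead C ->
    size A <= size B -> size B <= size C -> a + b + g = d c ->
  False.
Proof.
move=> cX [pA uA a0 da] [pB uB b0 db] [pC uC g0 dg] hAB hAC hBC AB BC abg.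
have u := arms_disjoint cX pA uA pB uB pC uC hAB hAC hBC.
have tk i j k : uniq (c :: take i A ++ take j B ++ take k C).
  apply: subseq_uniq u; rewrite /= eqxx.
  by do 2?[apply: cat_subseq; first exact: take_subseq]; apply: take_subseq.
have ptk D i : path e c D -> path e c (take i D).
  by rewrite -{1}(cat_take_drop i D) cat_path => /andP[].
case: A => [|a1 [|a2 A]] in pA uA da hAB hAC AB u tk *.
- by move: da {tk u} => /= da; clear -da a0 b0 g0 abg; lia.
- case: B => [|b1 [|b2 [|b3 B]]] // in pB uB db hAB hBC AB BC u tk *.
  + by move: da db => /= da db; clear -da db a0 b0 g0 abg; lia.
  + have /eqP : 6 * g = (size C).+1 * g.
      by move: da db dg => /= da db dg; clear -da db dg abg; lia.
    rewrite eqn_pmul2r // => /eqP/succn_inj/esym C5.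
    move: C5 {AB BC} tk pC {dg uC hAC hBC u}.
    case: C => [|c1 [|c2 [|c3 [|c4 [|c5 []]]]]] // _ tk pC.
    apply: notE; apply: (E8_euclidean cX pA pB pC); exact: (tk 1 2 5).
  case: C => [|c1 [|c2 [|c3 C]]] // in pC uC dg hAC hBC BC u tk *.
  have := (ptk _ 3 pB, ptk _ 3 pC, tk 1 3 3); rewrite /= !take0 => -[[pB3 pC3] u3].
  exact: notE (E7_euclidean cX pA pB3 pC3 u3).
case: B => [|b1 [|b2 B]] // in pB uB db hAB hBC AB BC u tk *.
case: C => [|c1 [|c2 C]] // in pC uC dg hAC hBC BC u tk *.
have := (ptk _ 2 pA, (ptk _ 2 pB, ptk _ 2 pC), tk 2 2 2).
rewrite /= !take0 => -[[pA2 [pB2 pC2]] u2].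
exact: notE (E6_euclidean cX pA2 pB2 pC2 u2).
Qed.

Lemma arm_exists c y : c \in X -> e c y ->
    (forall x, x \in X -> x != c -> #|nbrs x| <= 2) ->
  exists p t, [/\ arm c p t, ohead p = Some y & d y + t = d c].
Proof.
move=> cX cy deg2; have [p [cp up leaf]] := path_to_leaf cX cy.
have deg : {in belast y p, forall x, #|nbrs x| <= 2}.
  move=> x xp; have xyp : x \in y :: p by rewrite lastI mem_rcons in_cons xp orbT.
  apply: deg2; first by apply: (path_in_component cX cp); rewrite in_cons xyp orbT.
  by apply: contraTneq xyp => ->; case/andP: up.
have [dc dy] := arm_values cX cp up leaf deg.
exists (y :: p), (d (last y p)); split=> //.
by rewrite dc dy; lia.
Qed.

(** The balance [2 d c = d y1 + d y2 + d y3] at the branch vertex gives the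
    relation between arms excluded by [no_three_arms]. *)
Lemma branch_contra c : c \in X -> 2 < #|nbrs c| -> False.
Proof.
move=> cX deg3.
have deg2 x : x \in X -> x != c -> #|nbrs x| <= 2.
  move=> xX; apply: contraNleq => degx.
  by apply/eqP; apply: branch_unique.
have /card_geqP[s [us ss sN]] := deg3.
have Nc : nbrs c = [set z in s].
  apply/esym/eqP; rewrite eqEcard; apply/andP; split.
    by apply/subsetP => z; rewrite inE => /sN.
  rewrite (leq_trans (degree_le3 cX)) // -ss -(card_uniqP us).
  by apply/eq_leq/eq_card => z; rewrite !inE.
have := sum_nbrs cX; rewrite Nc.
case: s ss us sN {Nc} => [|y1 [|y2 [|y3 []]]] //= _ us sN.
have arm_at y : y \in [:: y1; y2; y3] ->
    exists p t, [/\ arm c p t, ohead p = Some y & d y + t = d c].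
  by move/sN; rewrite inE => cy; apply: arm_exists.
have [A [a [aA hA da]]] : exists p t,
    [/\ arm c p t, ohead p = Some y1 & d y1 + t = d c].
  by apply: arm_at; rewrite mem_head.
have [B [b [aB hB db]]] : exists p t,
    [/\ arm c p t, ohead p = Some y2 & d y2 + t = d c].
  by apply: arm_at; rewrite !in_cons eqxx orbT.
have [C [g [aC hC dg]]] : exists p t,
    [/\ arm c p t, ohead p = Some y3 & d y3 + t = d c].
  by apply: arm_at; rewrite !in_cons eqxx !orbT.
have -> : \sum_(y in [set z in [:: y1; y2; y3]]) d y = d y1 + d y2 + d y3.
  transitivity (\sum_(y <- [:: y1; y2; y3]) d y).
    by rewrite big_uniq //=; apply: eq_bigl => z; rewrite inE.
  by rewrite !big_cons big_nil addn0 addnA.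
move=> sumd; have abg : a + b + g = d c by lia.
move: us; rewrite /= !inE negb_or => /and3P[/andP[n12 n13] n23 _].
have hAB : ohead A != ohead B by rewrite hA hB.
have hAC : ohead A != ohead C by rewrite hA hC.
have hBC : ohead B != ohead C by rewrite hB hC.
have [ab|/ltnW ab] := leqP (size A) (size B);
  have [bc|/ltnW bc] := leqP (size B) (size C);
  have [ac|/ltnW ac] := leqP (size A) (size C).
- by apply: (no_three_arms cX aA aB aC).
- by apply: (no_three_arms cX aA aB aC).
- by apply: (no_three_arms cX aA aC aB); rewrite // 1?eq_sym //; lia.
- by apply: (no_three_arms cX aC aA aB); rewrite // 1?eq_sym //; lia.
- by apply: (no_three_arms cX aB aA aC); rewrite // 1?eq_sym //; lia.
- by apply: (no_three_arms cX aB aC aA); rewrite // 1?eq_sym //; lia.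
- by apply: (no_three_arms cX aC aB aA); rewrite // 1?eq_sym //; lia.
- by apply: (no_three_arms cX aC aB aA); rewrite // 1?eq_sym //; lia.
Qed.

(** Without branching the component is a path with a leaf [z] at either end.
    Seen as an arm that starts at [z], it gives [d z > d w] for the neighbour
    [w] of [z], against [d w = 2 d z]. *)
Lemma branchless_contra : (forall x, x \in X -> #|nbrs x| <= 2) -> False.
Proof.
move=> deg2; have rX : r \in X by rewrite inE.
have [y ry] : exists y, e r y.
  have [y ry|no] := pickP (e r); first by exists y.
  have := sum_nbrs rX; rewrite big_pred0; last by move=> y; rewrite inE no.
  by have := d_gt0 r; lia.
have [p [rp _ leaf]] := path_to_leaf rX ry.
have zX : last y p \in X.
  by apply: (path_in_component rX rp); rewrite in_cons mem_last orbT.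
have zw : e (last y p) (last r (belast y p)).
  by move/setP: leaf => /(_ (last r (belast y p))); rewrite !inE eqxx.
have [q [t [[_ _ t0 dz] _ dw]]] := arm_exists zX zw (fun x xX _ => deg2 x xX).
by have := sum_nbrs zX; rewrite leaf big_set1; lia.
Qed.
End NotEuclidean.

Lemma component_euclidean : euclidean_on X.
Proof.
apply: contrapT => notE; apply: (branchless_contra notE) => x xX.
by rewrite leqNgt; apply/negP; apply: branch_contra.
Qed.
End HarmonicGraph.

(** Loops would add further cases, such as a path with a loop at either end and
    constant [d]. *)
Theorem harmonic_euclidean_union (V : finType) (Q : multigraph V) (d : V -> nat) :
    undirected Q -> (forall x, Q x x = 0) -> (forall x, 0 < d x) ->
    (forall x, \sum_y Q x y * d y = 2 * d x) ->
  euclidean_union Q.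
Proof.
move=> Qsym Q0 d0 hd _ /imsetP[r _ ->].
exact: component_euclidean Qsym Q0 d0 hd r.
Qed.

(** * Dimensions of spaces of homomorphisms as character sums *)

Import GRing.Theory Num.Theory.

Section HomDimension.
Local Open Scope ring_scope.

Lemma mxtrace_idempotent (F : fieldType) n (P : 'M[F]_n) :
  P *m P = P -> \tr P = (\rank P)%:R.
Proof.
move=> PP; rewrite -{1}(mulmx_base P) mxtrace_mulC.
have -> : row_base P *m col_base P = 1%:M.
  apply: (row_free_inj (row_base_free P)); apply: (row_full_inj (col_base_full P)).
  by rewrite mul1mx -[_ *m _ *m row_base P]mulmxA mulmx_base mulmxA mulmx_base PP.
by rewrite mxtrace1.
Qed.

Lemma mul_mxvec_sandwich (F : fieldType) m n (A : 'M[F]_m) (B : 'M[F]_n)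
    (f : 'M_(m, n)) :
  mxvec f *m (lin_mulmx A *m lin_mulmxr B) = mxvec (A *m f *m B).
Proof. by rewrite mulmxA !mul_vec_lin. Qed.

(** The action of a group on [Hom(V, W)] is by maps [f |-> A f B]; this is its
    character. *)
Lemma mxtrace_sandwich (F : fieldType) m n (A : 'M[F]_m) (B : 'M[F]_n) :
  \tr (lin_mulmx A *m lin_mulmxr B : 'M_(m * n)) = \tr A * \tr B.
Proof.
set P := _ *m _.
have PE i j : P (mxvec_index i j) (mxvec_index i j) = A i i * B j j.
  pose k := mxvec_index i j.
  transitivity (((delta_mx 0 k : 'rV_(m * n)) *m P) 0 k).
    by rewrite -rowE [RHS]mxE.
  rewrite -mxvec_delta mul_mxvec_sandwich mxvecE -mulmxA mxE.
  rewrite (bigD1 i) //= big1 ?addr0.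
    rewrite mxE (bigD1 j) //= big1 ?addr0 => [|l lj]; rewrite mxE ?eqxx ?mul1r //.
    by rewrite (negbTE lj) andbF mul0r.
  move=> l li; rewrite mxE big1 ?mulr0 // => l' _.
  by rewrite mxE (negbTE li) mul0r.
rewrite /mxtrace (reindex _ (curry_mxvec_bij _ _)) /=.
rewrite (eq_bigr (fun ij => A ij.1 ij.1 * B ij.2 ij.2)); last first.
  by move=> [i j] _; apply: PE.
rewrite -(pair_bigA _ (fun i j => A i i * B j j)) /= big_distrl.
by apply: eq_bigr => i _; rewrite big_distrr.
Qed.

(** A matrix with row space [U], flattened: it transfers [\dim] to [\rank], and
    hence to traces. *)
Definition vspace_rows (F : fieldType) m n (U : {vspace 'M[F]_(m, n)}) :
    'M[F]_(\dim U, m * n) := \matrix_i mxvec (vbasis U)`_i.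

Lemma row_free_vspace_rows (F : fieldType) m n (U : {vspace 'M[F]_(m, n)}) :
  row_free (vspace_rows U).
Proof.
apply: inj_row_free => v /(congr1 vec_mx); rewrite linear0 mulmx_sum_row linear_sum.
move=> v0; have /freeP/(_ (v 0)) := basis_free (vbasisP U).
move=> v_0; apply/rowP => i; rewrite mxE v_0 // -[RHS]v0; apply: eq_bigr => j _.
by rewrite linearZ /= rowK mxvecK.
Qed.

Lemma sub_vspace_rows (F : fieldType) m n (U : {vspace 'M[F]_(m, n)})
    (v : 'rV_(m * n)) :
  (v <= vspace_rows U)%MS = (vec_mx v \in U).
Proof.
apply/submxP/idP => [[u ->]|vU].
  rewrite mulmx_sum_row linear_sum rpred_sum // => i _.
  by rewrite linearZ /= rowK mxvecK rpredZ // vbasis_mem // mem_nth // size_tuple.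
exists (\row_i coord (vbasis U) i (vec_mx v)).
rewrite -[LHS]vec_mxK [in LHS](coord_vbasis vU) linear_sum mulmx_sum_row.
by apply: eq_bigr => i _; rewrite linearZ rowK [in RHS]mxE.
Qed.

Variables (C : numClosedFieldType) (gT : finGroupType) (G : {group gT}).

(** On characters, the value of [u] at [g^-1] is the conjugate of its value at
    [g], so this is the usual Hermitian product; written this way it is
    bilinear, and no conjugation enters. *)
Definition pairing (u v : gT -> C) : C :=
  #|G|%:R^-1 * \sum_(g in G) u g^-1%g * v g.

Definition chi n (rV : mx_representation C G n) (g : gT) : C := \tr (rV g).

Let G0 : #|G|%:R != 0 :> C.
Proof. by rewrite pnatr_eq0 -lt0n cardG_gt0. Qed.

(** Averaging over [G] projects the space of all matrices onto the
    homomorphisms, and the dimension of the image of a projection is its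
    trace. *)
Lemma dim_hom_space m n (rV : mx_representation C G m)
    (rW : mx_representation C G n) :
  (\dim (hom_space rV rW))%:R = pairing (chi rV) (chi rW).
Proof.
pose S g := lin_mulmx (rV g^-1%g) *m lin_mulmxr (rW g) : 'M[C]_(m * n).
pose P : 'M[C]_(m * n) := #|G|%:R^-1 *: \sum_(g in G) S g.
have PE f : mxvec f *m P
    = mxvec (#|G|%:R^-1 *: \sum_(g in G) rV g^-1%g *m f *m rW g).
  rewrite -scalemxAr mulmx_sumr linearZ /=.
  rewrite [mxvec (\sum_(i in G) _)]linear_sum; congr (_ *: _).
  by apply: eq_bigr => g _; rewrite mul_mxvec_sandwich.
have Pid f : f \in hom_space rV rW -> mxvec f *m P = mxvec f.
  move/hom_spaceP=> fh; rewrite PE; congr mxvec.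
  rewrite (eq_bigr (fun=> f)) => [|g Gg].
    by rewrite sumr_const -scaler_nat scalerA mulVf // scale1r.
  by rewrite -mulmxA -fh // mulmxA -repr_mxM ?groupV // mulVg repr_mx1 mul1mx.
have Phom f : vec_mx (mxvec f *m P) \in hom_space rV rW.
  apply/hom_spaceP => h Gh; rewrite PE mxvecK -scalemxAr -scalemxAl; congr (_ *: _).
  rewrite mulmx_sumr mulmx_suml [RHS](reindex_inj (mulIg h^-1%g)) /=.
  apply: eq_big => [g|g Gg]; first by rewrite groupMr ?groupV.
  rewrite invMg invgK -[_ *m rW h]mulmxA -repr_mxM ?groupM ?groupV // mulgKV.
  by rewrite !mulmxA -repr_mxM ?groupV.
have PP : P *m P = P.
  apply/row_matrixP => k; rewrite !rowE mulmxA.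
  by have := Pid _ (Phom (vec_mx (delta_mx 0 k))); rewrite !vec_mxK.
have -> : \dim (hom_space rV rW) = \rank P.
  rewrite -(eqP (row_free_vspace_rows (hom_space rV rW))).
  apply/eqmx_rank/andP; split; apply/rV_subP => v; last first.
    case/submxP => u ->; rewrite sub_vspace_rows.
    by have := Phom (vec_mx u); rewrite vec_mxK.
  by rewrite sub_vspace_rows => /Pid; rewrite vec_mxK => <-; apply: submxMl.
rewrite -mxtrace_idempotent // /P mxtraceZ linear_sum /=; congr (_ * _).
by apply: eq_bigr => g _; rewrite mxtrace_sandwich.
Qed.
End HomDimension.

(** * Characters and tensor product graphs *)

Section Schur.
Local Open Scope ring_scope.
Variables (C : numClosedFieldType) (gT : finGroupType) (G : {group gT}).

Lemma chi1 n (rV : mx_representation C G n) : chi rV 1%g = n%:R.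
Proof. by rewrite /chi repr_mx1 mxtrace1. Qed.

Lemma irr_cent_scalar n (rV : mx_representation C G n) A :
  mx_irreducible rV -> {in G, forall g, rV g *m A = A *m rV g} ->
  exists a, A = a%:M.
Proof.
move=> /group_closure_closed_field irrV cA; apply/is_scalar_mxP.
by apply: (mx_abs_irr_cent_scalar irrV); apply/centgmxP => g Gg; rewrite cA.
Qed.

Lemma dim_hom_irr n (rV : mx_representation C G n) :
  mx_irreducible rV -> \dim (hom_space rV rV) = 1%N.
Proof.
move=> irrV; have n0 : (0 < n)%N by case/mx_irrP: irrV.
have -> : hom_space rV rV = <[1%:M]>%VS.
  apply/vspaceP => A; apply/hom_spaceP/vlineP;
    [move/(irr_cent_scalar irrV)=> [a ->] | move=> [a ->] g _].
    by exists a; rewrite scalemx1.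
  by rewrite scalemx1 scalar_mxC.
by rewrite dim_vline -mxrank_eq0 mxrank1 -lt0n n0.
Qed.

Lemma hom_irr_rsim m n (rV : mx_representation C G m)
    (rW : mx_representation C G n) (f : 'M[C]_(m, n)) :
  mx_irreducible rV -> mx_irreducible rW -> f \in hom_space rV rW -> f != 0 ->
  mx_rsim rV rW.
Proof.
move=> /mx_irrP[_ irrV] /mx_irrP[_ irrW] /hom_spaceP fh f0.
have ker0 : kermx f = 0.
  apply/eqP; apply: contraNT f0 => /irrV ker; apply/eqP.
  rewrite -[f]mul1mx; apply/sub_kermxP; rewrite sub1mx; apply: ker.
  apply/mxmoduleP => g Gg; apply/sub_kermxP.
  by rewrite -mulmxA fh // mulmxA mulmx_ker mul0mx.
have free_f : row_free f by rewrite -kermx_eq0 ker0.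
have full_f : row_full f.
  rewrite -sub1mx -(genmxE f) sub1mx; apply: irrW.
    apply/mxmoduleP => g Gg; rewrite (eqmxMr _ (genmxE f)) genmxE -fh //.
    exact: submxMl.
  by rewrite -mxrank_eq0 genmxE mxrank_eq0.
by exists f => //; rewrite -(eqP free_f) (eqP full_f).
Qed.

Variables (r : nat) (d : 'I_r.+1 -> nat).
Variable V : forall i, mx_representation C G (d i).
Hypothesis irrV : irr_list V.

Lemma chi_orthonormal i j : pairing G (chi (V i)) (chi (V j)) = (i == j)%:R.
Proof.
have [irr simV _] := irrV; rewrite -dim_hom_space; congr (_%:R).
have [<-|ij] := eqVneq; first exact: dim_hom_irr.
apply/eqP; rewrite dimv_eq0; apply/eqP/vspaceP => f; rewrite memv0.
apply/idP/eqP => [fh|->]; last exact: mem0v.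
apply/eqP; apply: contraNT ij => f0; apply/eqP/simV.
exact: hom_irr_rsim fh f0.
Qed.

(** Traces are additive over subrepresentations and quotients, so a
    composition series expresses any of them by irreducible ones. *)
Lemma char_nat_combination n (rU : mx_representation C G n) :
  exists m : 'I_r.+1 -> nat,
    {in G, forall g, chi rU g = \sum_i (m i)%:R * chi (V i) g}.
Proof.
have [_ _ complete] := irrV.
elim/ltn_ind: n rU => -[|n] IH rU.
  exists (fun=> 0%N) => g _; rewrite big1 => [|i _]; last by rewrite mul0r.
  by rewrite /chi /mxtrace big_ord0.
have nz1 : (1%:M : 'M[C]_n.+1) != 0 by rewrite -mxrank_eq0 mxrank1.
have [[U /and4P[modU _ nzU ltU]]|simple1] := mxnonsimpleP rU nz1; last first.
  have /complete[i simU] : mx_irreducible rU.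
    by apply/mxsimpleP; split=> //; apply: mxmodule1.
  exists (fun k => k == i) => g Gg; rewrite (bigD1 i) //= eqxx mul1r big1 ?addr0.
    exact: mxtrace_rsim.
  by move=> k /negbTE->; rewrite mul0r.
rewrite mxrank1 in ltU.
have [m1 sub] := IH _ ltU (submod_repr modU).
have ltC : (\rank (cokermx U) < n.+1)%N.
  by rewrite mxrank_coker; move: nzU; rewrite -mxrank_eq0; lia.
have [m2 quo] := IH _ ltC (factmod_repr modU).
exists (fun i => m1 i + m2 i)%N => g Gg.
rewrite /chi -(mxtrace_sub_fact_mod modU) //.
rewrite -/(chi (submod_repr modU) g) -/(chi (factmod_repr modU) g) sub // quo //.
by rewrite -big_split; apply: eq_bigr => i _; rewrite natrD mulrDl.
Qed.

Lemma eq_pairing (u u' v v' : gT -> C) :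
    {in G, forall g, u g = u' g} -> {in G, forall g, v g = v' g} ->
  pairing G u v = pairing G u' v'.
Proof.
move=> uu vv; congr (_ * _); apply: eq_bigr => g Gg.
by rewrite uu ?vv // groupV.
Qed.

Lemma pairing_sumr (u : gT -> C) m (v : 'I_m -> gT -> C) (c : 'I_m -> C) :
  pairing G u (fun g => \sum_i c i * v i g) = \sum_i c i * pairing G u (v i).
Proof.
rewrite /pairing; under eq_bigr do rewrite big_distrr.
rewrite exchange_big big_distrr; apply: eq_bigr => i _ /=.
rewrite mulrCA; congr (_ * _); rewrite big_distrr; apply: eq_bigr => g _.
by rewrite mulrCA.
Qed.

Lemma pairing_suml (u : gT -> C) m (v : 'I_m -> gT -> C) (c : 'I_m -> C) :
  pairing G (fun g => \sum_i c i * v i g) u = \sum_i c i * pairing G (v i) u.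
Proof.
rewrite /pairing; under eq_bigr do rewrite big_distrl.
rewrite exchange_big big_distrr; apply: eq_bigr => i _ /=.
rewrite mulrCA; congr (_ * _); rewrite big_distrr; apply: eq_bigr => g _.
by rewrite /= -mulrA.
Qed.

Lemma char_decomposition n (rU : mx_representation C G n) :
  {in G, forall g, chi rU g = \sum_i (\dim (hom_space (V i) rU))%:R * chi (V i) g}.
Proof.
have [m mE] := char_nat_combination rU; move=> g Gg.
rewrite mE //; apply: eq_bigr => i _; congr (_ * _).
rewrite dim_hom_space (eq_pairing (fun _ _ => erefl _) mE) pairing_sumr.
rewrite (bigD1 i) //= chi_orthonormal eqxx mulr1 big1 ?addr0 // => j ji.
by rewrite chi_orthonormal eq_sym (negbTE ji) mulr0.
Qed.

Lemma chi_prod m n (rU : mx_representation C G m) (rW : mx_representation C G n) g :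
  chi (prod_repr rU rW) g = chi rU g * chi rW g.
Proof. exact: mxtrace_prod. Qed.

Section TensorGraph.
Variables (n : nat) (rW : mx_representation C G n).

Definition tensor_graph : multigraph 'I_r.+1 :=
  fun i j => \dim (hom_space (V i) (prod_repr rW (V j))).

Lemma tensor_graphE i j :
  (tensor_graph i j)%:R = pairing G (chi (V i)) (fun g => chi rW g * chi (V j) g).
Proof.
by rewrite dim_hom_space; apply: eq_pairing => // g _; rewrite chi_prod.
Qed.

Lemma tensor_char j : {in G, forall g,
  chi rW g * chi (V j) g = \sum_i (tensor_graph i j)%:R * chi (V i) g}.
Proof. by move=> g Gg; rewrite -chi_prod char_decomposition. Qed.

Hypothesis selfdual : {in G, forall g, chi rW g^-1%g = chi rW g}.

Lemma tensor_graph_undirected : undirected tensor_graph.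
Proof.
move=> i j; apply/eqP; rewrite -(eqr_nat C) !tensor_graphE /pairing; apply/eqP.
congr (_ * _); rewrite (reindex_inj invg_inj) /=; apply: eq_big => g.
  by rewrite groupV.
by rewrite groupV => Gg; rewrite invgK selfdual // mulrC mulrA [_ * chi rW g]mulrC.
Qed.

(** The identity [chi rW * chi (V i) = \sum_j (tensor_graph j i) chi (V j)],
    evaluated at the identity element. *)
Lemma tensor_graph_harmonic i : (\sum_j tensor_graph i j * d j = n * d i)%N.
Proof.
apply/eqP; rewrite -(eqr_nat C) natrM natr_sum -!(chi1 rW) -(chi1 (V i)).
rewrite tensor_char //; apply/eqP/eq_bigr => j _.
by rewrite natrM tensor_graph_undirected chi1.
Qed.
End TensorGraph.
End Schur.

(** * Bipartition by a central involution *)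

Section Central.
Local Open Scope ring_scope.
Variables (C : numClosedFieldType) (gT : finGroupType) (G : {group gT}).
Variables (r : nat) (d : 'I_r.+1 -> nat).
Variable V : forall i, mx_representation C G (d i).
Hypothesis irrV : irr_list V.

Variable z : gT.
Hypotheses (Gz : z \in G) (zz : (z * z)%g = 1%g).
Hypothesis cz : {in G, forall g, (z * g = g * z)%g}.

Definition colour i := V i z == 1%:M.

(** By Schur's lemma [V i z] is a scalar, and its square is 1. *)
Lemma central_sign i : V i z = (if colour i then 1 else -1)%:M.
Proof.
have [irr _ _] := irrV; rewrite /colour; case: eqP => // Vz1.
have [a Va] : exists a, V i z = a%:M.
  apply: (irr_cent_scalar (irr i)) => g Gg.
  by rewrite -!repr_mxM // cz.
have aa : (a ^+ 2)%:M = 1%:M :> 'M[C]_(d i).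
  by rewrite expr2 scalar_mxM -Va -repr_mxM // zz repr_mx1.
have /eqP : a ^+ 2 = 1.
  have /mx_irrP[d0 _] := irr i.
  by have /matrixP/(_ (Ordinal d0) (Ordinal d0)) := aa; rewrite !mxE eqxx.
by rewrite sqrf_eq1 => /orP[]/eqP a1; rewrite Va a1 // in Vz1 *.
Qed.

(** The substitution [g |-> z g] in the character formula for the number of
    edges multiplies it by the signs of [z] on [V i], on [rW] and on [V j]; if the
    first and the last agree, the number is its own opposite. *)
Lemma tensor_graph_bipartite n (rW : mx_representation C G n) :
    {in G, forall g, chi rW (z * g)%g = - chi rW g} ->
  forall i j, adjacent (tensor_graph V rW) i j -> colour i != colour j.
Proof.
move=> Wz i j; rewrite /adjacent; apply: contraTneq => cij; rewrite -eqn0Ngt.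
rewrite -(eqr_nat C) tensor_graphE; set p := pairing _ _ _.
suff : p = - p by move/eqP; rewrite -addr_eq0 -mulr2n mulrn_eq0.
rewrite /p /pairing [in LHS](reindex_inj (mulgI z)) /= -mulrN -sumrN; congr (_ * _).
apply: eq_big => g; first by rewrite groupMl.
rewrite groupMl // => Gg; rewrite Wz // mulNr mulrN; congr (- _).
have zV : (z^-1 = z)%g by rewrite -[LHS]mulg1 -zz mulKg.
have chi_z k h : h \in G ->
    chi (V k) (z * h)%g = (if colour k then 1 else -1) * chi (V k) h.
  by move=> Gh; rewrite /chi repr_mxM // central_sign mul_scalar_mx mxtraceZ.
rewrite invMg zV -cz ?groupV // !chi_z ?groupV // cij.
by case: (colour j); rewrite ?mul1r // !mulN1r mulrN mulrN mulNr opprK.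
Qed.
End Central.

(** * Transversality *)

Section Transversality.
Local Open Scope ring_scope.
Variables (C : numClosedFieldType) (gT : finGroupType) (G : {group gT}).
Variables (r : nat) (d : 'I_r.+1 -> nat).
Variable V : forall i, mx_representation C G (d i).
Hypothesis irrV : irr_list V.

Definition spanned (X : {set 'I_r.+1}) (u : gT -> C) :=
  exists2 c : 'I_r.+1 -> C, (forall k, k \notin X -> c k = 0)
    & {in G, forall g, u g = \sum_k c k * chi (V k) g}.

Lemma spanned_pairing0 X Y u v : spanned X u -> spanned Y v -> X :&: Y = set0 ->
  pairing G u v = 0.
Proof.
move=> [a aX uE] [b bY vE] XY.
rewrite (eq_pairing uE vE) pairing_suml big1 // => i _.
rewrite pairing_sumr (bigD1 i) //= big1 => [|j ji]; last first.
  by rewrite chi_orthonormal // eq_sym (negbTE ji) mulr0.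
rewrite addr0; have [iX|/aX->] := boolP (i \in X); last by rewrite mul0r.
rewrite bY ?mul0r ?mulr0 //; apply: contraTN iX => iY.
by apply: contraFN (in_set0 i) => iX; rewrite -XY inE iX.
Qed.

Lemma spanned_chi (X : {set 'I_r.+1}) i : i \in X -> spanned X (chi (V i)).
Proof.
move=> iX; exists (fun k => (k == i)%:R) => [k kX|g _].
  by case: eqP => // ki; rewrite ki iX in kX.
by rewrite (bigD1 i) //= eqxx mul1r big1 ?addr0 // => k /negbTE->; rewrite mul0r.
Qed.

Lemma spanned_linear X u v (a : C) : spanned X u -> spanned X v ->
  spanned X (fun g => u g + a * v g).
Proof.
move=> [b bX uE] [c cX vE]; exists (fun k => b k + a * c k) => [k kX|g Gg].
  by rewrite bX // cX // mulr0 addr0.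
rewrite uE // vE // big_distrr -big_split; apply: eq_bigr => k _ /=.
by rewrite mulrDl mulrA.
Qed.

Lemma spanned_mul n (rW : mx_representation C G n) (X : {set 'I_r.+1}) u :
    (forall k j, j \in X -> k \notin X -> tensor_graph V rW k j = 0%N) ->
  spanned X u -> spanned X (fun g => chi rW g * u g).
Proof.
move=> Xcl [c cX uE].
exists (fun k => \sum_j c j * (tensor_graph V rW k j)%:R) => [k kX|g Gg].
  apply: big1 => j _; have [jX|/cX->] := boolP (j \in X); last by rewrite mul0r.
  by rewrite Xcl // mulr0.
rewrite uE // big_distrr; under [RHS]eq_bigr do rewrite big_distrl.
rewrite exchange_big; apply: eq_bigr => j _ /=.
rewrite mulrCA tensor_char // big_distrr; apply: eq_bigr => k _.
by rewrite /= mulrA.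
Qed.

(** Tensoring with [rW] moves the support along edges only, so multiplication by
    polynomials in its character preserves a component. *)
Lemma spanned_poly n (rW : mx_representation C G n) (X : {set 'I_r.+1}) i
    (p : {poly C}) :
    (forall k j, j \in X -> k \notin X -> tensor_graph V rW k j = 0%N) ->
  i \in X -> spanned X (fun g => p.[chi rW g] * chi (V i) g).
Proof.
move=> Xcl iX; elim/poly_ind: p => [|p c IH].
  exists (fun=> 0) => // g _; rewrite horner0 mul0r big1 // => k _.
  by rewrite mul0r.
have [a aX aE] := spanned_linear c (spanned_mul Xcl IH) (spanned_chi iX).
exists a => // g Gg.
by rewrite -aE // hornerMXaddC mulrDl mulrA [chi rW g * _]mulrC.
Qed.

Lemma tensor_graph_component_closed n (rW : mx_representation C G n) X :
    {in G, forall g, chi rW g^-1%g = chi rW g} ->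
    X \in components (tensor_graph V rW) ->
  forall k j, j \in X -> k \notin X -> tensor_graph V rW k j = 0%N.
Proof.
move=> sd /imsetP[x _ ->] k j; rewrite !inE => xj; apply: contraNeq.
rewrite -lt0n tensor_graph_undirected // => jk.
by apply: connect_trans xj (connect1 _).
Qed.

(** On the values of [w], this vanishes everywhere but at [a]. *)
Definition peak (w : gT -> C) (a : C) : {poly C} :=
  \prod_(g in G | w g != a) ('X - (w g)%:P).

Lemma peak_neq0 w a : (peak w a).[a] != 0.
Proof.
rewrite horner_prod; apply/prodf_neq0 => g /andP[_ wa].
by rewrite hornerXsubC subr_eq0 eq_sym.
Qed.

Lemma peak_eq0 (w : gT -> C) a g : g \in G -> w g != a -> (peak w a).[w g] = 0.
Proof.
move=> Gg wa; rewrite horner_prod (bigD1 g) /= ?Gg //.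
by rewrite hornerXsubC subrr mul0r.
Qed.

(** Suppose that the components [X] of [V i] and [Y] of [V j] are disjoint. Then
    [p1(w1) chi_i] and [p2(w2) chi_j] are orthogonal for all polynomials [p1] and
    [p2], where [w1], [w2] are the characters of the two representations. With
    [p1], [p2] peaked at the degrees, the sum defining the pairing is reduced
    to its term at 1, which is nonzero because it is a multiple of
    [d i * d j]. *)
Lemma tensor_graphs_transversal n1 n2 (rW1 : mx_representation C G n1)
    (rW2 : mx_representation C G n2) :
    {in G, forall g, chi rW1 g^-1%g = chi rW1 g} ->
    {in G, forall g, chi rW2 g^-1%g = chi rW2 g} ->
    {in G, forall g, chi rW1 g = n1%:R -> chi rW2 g = n2%:R -> g = 1%g} ->
  transversal_components (tensor_graph V rW1) (tensor_graph V rW2).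
Proof.
move=> sd1 sd2 faithful X Y cX cY; apply/eqP => XY.
have [irr _ _] := irrV.
have [i iX] : exists i, i \in X by case/imsetP: cX => i _ ->; exists i; rewrite inE.
have [j jY] : exists j, j \in Y by case/imsetP: cY => j _ ->; exists j; rewrite inE.
have := spanned_pairing0
  (spanned_poly (peak (chi rW1) n1%:R) (tensor_graph_component_closed sd1 cX) iX)
  (spanned_poly (peak (chi rW2) n2%:R) (tensor_graph_component_closed sd2 cY) jY) XY.
apply/eqP; rewrite /pairing (bigD1 1%g) //= big1 ?addr0 => [|g /andP[Gg g1]].
  have dim0 k : (d k)%:R != 0 :> C.
    by have /mx_irrP[d0 _] := irr k; rewrite pnatr_eq0 -lt0n.
  rewrite invg1 !chi1 !mulf_eq0 invr_eq0 !negb_or !dim0 !peak_neq0 pnatr_eq0.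
  by rewrite -lt0n cardG_gt0.
rewrite sd1 //; have [w1|w1] := eqVneq (chi rW1 g) n1%:R; last first.
  by rewrite peak_eq0 // !mul0r.
have [w2|w2] := eqVneq (chi rW2 g) n2%:R; last first.
  by rewrite (peak_eq0 Gg w2) mul0r mulr0.
by rewrite (faithful g) ?eqxx in g1.
Qed.
End Transversality.

(** * Traces in SU(2) and the two factors *)

Section SU2.
Local Open Scope ring_scope.
Variable C : numClosedFieldType.

(** The inverse is the adjugate, whose diagonal is that of [A] with the two
    entries exchanged. *)
Lemma mxtrace2_inv (A : 'M[C]_2) : \det A = 1 -> \tr (invmx A) = \tr A.
Proof.
move=> dA; rewrite /invmx unitmxE dA unitr1 invr1 scale1r.
rewrite /mxtrace !big_ord_recl !big_ord0 !addr0 addrC !mxE /cofactor.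
rewrite !det_mx11 !mxE /= expr0 !mul1r -signr_odd /= expr0 mul1r.
by congr (A _ _ + A _ _); apply/val_inj.
Qed.

Lemma gram_eq0 m n (B : 'M[C]_(m, n)) :
  \tr (B *m (map_mx Num.conj B)^T) = 0 -> B = 0.
Proof.
move=> tB; apply/matrixP => i j; rewrite mxE.
have ge0 k l : 0 <= B k l * (B k l)^* by apply: mul_conjC_ge0.
have {}tB : \sum_k \sum_l B k l * (B k l)^* = 0.
  rewrite -[RHS]tB; apply: eq_bigr => k _; rewrite mxE; apply: eq_bigr => l _.
  by rewrite !mxE.
have row0 : \sum_l B i l * (B i l)^* = 0.
  by apply: (psumr_eq0P _ tB) => // k _; apply: sumr_ge0.
have := psumr_eq0P (fun l _ => ge0 i l) row0; move/(_ j isT)/eqP.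
by rewrite mul_conjC_eq0 => /eqP.
Qed.

(** The squared Frobenius norm of [A - 1] is [2 n - \tr A - conj (\tr A)]. *)
Lemma unitary_trace_max n (A : 'M[C]_n) :
  A \is unitarymx -> \tr A = n%:R -> A = 1%:M.
Proof.
move=> /unitarymxP uA tA; apply/eqP; rewrite -subr_eq0; apply/eqP/gram_eq0.
have tA' : \tr (map_mx Num.conj A)^T = n%:R.
  by rewrite mxtrace_tr trace_map_mx tA rmorph_nat.
rewrite map_mxB map_mx1 linearB /= trmx1 mulmxBl !mulmxBr mul1mx !mulmx1.
have -> : A *m (map_mx Num.conj A)^T = 1%:M by rewrite -uA map_trmx.
by rewrite !linearB /= tA tA' mxtrace1 !subrr.
Qed.
End SU2.

Section McKay.
Local Open Scope ring_scope.
Variables (C : numClosedFieldType) (G : fin_subgroup (SU C 2 * SU C 2)%type).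

Definition factor_mx (k : bool) (g : elts G) : 'M[C]_2 :=
  if k then (val g).2 else (val g).1.

Fact factor_mx_repr k : mx_repr [set: elts G] (factor_mx k).
Proof. by case: k; split. Qed.

Definition factor_repr k := MxRepresentation (factor_mx_repr k).

Lemma factor_unitary k g :
  (factor_mx k g \is unitarymx) && (\det (factor_mx k g) == 1).
Proof. by rewrite /factor_mx; case: k; apply: SUvalP. Qed.

Lemma factor_selfdual k :
  {in [set: elts G], forall g, chi (factor_repr k) g^-1%g = chi (factor_repr k) g}.
Proof.
move=> g _; have /andP[_ /eqP dg] := factor_unitary k g.
by rewrite /chi -[RHS]mxtrace2_inv // repr_mxV ?inE.
Qed.

Lemma factor_faithful : {in [set: elts G], forall g,
  chi (factor_repr false) g = 2%:R -> chi (factor_repr true) g = 2%:R -> g = 1%g}.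
Proof.
move=> g _ g1 g2.
have /andP[/unitary_trace_max/(_ g1) e1 _] := factor_unitary false g.
have /andP[/unitary_trace_max/(_ g2) e2 _] := factor_unitary true g.
by apply/val_inj; rewrite [LHS]surjective_pairing; congr pair; apply/val_inj.
Qed.

Lemma chi_natural g :
  chi (natural_repr G) g = chi (factor_repr false) g + chi (factor_repr true) g.
Proof. exact: mxtrace_block. Qed.

(** The character of [natural_repr G] is the sum of those of the two factors,
    and numbers of edges are linear in it. *)
Lemma mckay_split (r : nat) (d : 'I_r.+1 -> nat)
    (V : forall i, mx_representation C [set: elts G] (d i)) i j :
  mckay V i j = (tensor_graph V (factor_repr false) i j
                 + tensor_graph V (factor_repr true) i j)%N.
Proof.
have mckayE := tensor_graphE V (natural_repr G) i j.
have factorE k := tensor_graphE V (factor_repr k) i j.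
apply/eqP; rewrite -(eqr_nat C) natrD; apply/eqP.
have sumE := congr2 +%R (factorE false) (factorE true).
apply: eq_trans mckayE (eq_trans _ (esym sumE)).
rewrite /pairing -mulrDr -big_split; congr (_ * _); apply: eq_bigr => g _.
by rewrite chi_natural mulrDl mulrDr.
Qed.
End McKay.

Theorem theorem4 (R : realType)
    (G : fin_subgroup (SU R[i] 2 * SU R[i] 2)%type)
    (GN1 : (SU2_N1 R[i], SU2_N1 R[i]) \in fin_subgroup_set G)
    (r : nat) (d : 'I_r.+1 -> nat)
    (V : forall i : 'I_r.+1, mx_representation R[i] [set: elts G] (d i))
    (irrV : irr_list V) :
  [/\ undirected (mckay V),
      bipartite (mckay V)
    & exists Q1 Q2 : multigraph 'I_r.+1,
        [/\ edge_decomposition (mckay V) Q1 Q2,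
            euclidean_union Q1, euclidean_union Q2
          & transversal_components Q1 Q2]].
Proof.
pose Q k := tensor_graph V (factor_repr G k).
pose z : elts G := FSetSub GN1.
have Qsym k : undirected (Q k).
  by apply: tensor_graph_undirected; apply: factor_selfdual.
have zg k g : factor_mx k (z * g)%g = (- factor_mx k g)%R.
  by case: k; rewrite /factor_mx /= mulNmx mul1mx.
have Qcol k x y : adjacent (Q k) x y -> colour V z x != colour V z y.
  apply: (tensor_graph_bipartite irrV); rewrite ?inE //.
  - apply/val_inj; congr pair; apply/val_inj;
    by rewrite /= mulNmx mul1mx opprK.
  - move=> g _; apply/val_inj; congr pair; apply/val_inj;
    by rewrite /= mulNmx mulmxN mul1mx mulmx1.
  by move=> g _; rewrite /chi /= zg linearN.
have Qeuclid k : euclidean_union (Q k).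
  apply: (@harmonic_euclidean_union _ _ d) => // x.
  - by apply/eqP; rewrite eqn0Ngt; apply/negP => /Qcol; rewrite eqxx.
  - by have [irr _ _] := irrV; have /mx_irrP[] := irr x.
  - by apply: (tensor_graph_harmonic irrV); apply: factor_selfdual.
have mckayQ x y : mckay V x y = Q false x y + Q true x y by apply: mckay_split.
split.
- by move=> x y; rewrite !mckayQ !(Qsym _ x).
- exists (colour V z) => x y; rewrite /adjacent mckayQ addn_gt0.
  by case/orP; apply: Qcol.
exists (Q false), (Q true); split=> //.
apply: (tensor_graphs_transversal irrV); try exact: factor_selfdual.
exact: factor_faithful.
Qed.
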